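(* Let $n \ge 1$ and $\Sigma=\{0,1\}$. Let $\mathring{R}_{n+1}$ be the set of all non-empty circularly representable subsets of $\Sigma^{n+1}$. Then $$|\mathring{R}_{n+1}| \;\ge\; 2^{2^n} = \left(\sqrt{2}\right)^{2^{n+1}}.$$
   Context: $\Sigma=\{0,1\}$. For a non-empty word $w$ over $\Sigma$ and $m\ge 1$, $C_m(w)$ denotes the set of length-$m$ factors of $w$ when $w$ is interpreted circularly, i.e. the set of words $w[i]w[i+1]\cdots w[i+m-1]$ for $1\le i\le |w|$, with indices taken modulo $|w|$. A subset $S\subseteq\Sigma^m$ is circularly representable if there is a non-empty word $w$ with $C_m(w)=S$ (one says $w$ circularly witnesses $S$). $\mathring{R}_m$ is the set of all non-empty circularly representable subsets of $\Sigma^m$. *)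

(* Defs.v *)
From HB Require Import structures.
From mathcomp Require Import all_boot all_order all_algebra.
From mathcomp Require Import boolp reals.

Set Implicit Arguments.
Unset Strict Implicit.
Unset Printing Implicit Defensive.

(* The alphabet {0,1} is [bool], with 0 = false and 1 = true.                 *)

(* Positions are numbered from 0.  The word may be shorter than the factor,   *)
(* in which case the factor wraps around it several times.                    *)
Definition circular_factor (m : nat) (w : seq bool) (i : nat) : m.-tuple bool :=
  [tuple nth false w ((i + j) %% size w) | j < m].

Definition circular_factors (m : nat) (w : seq bool) : {set m.-tuple bool} :=
  [set circular_factor m w i | i : 'I_(size w)].

Definition circularly_representable (m : nat) (S : {set m.-tuple bool}) : Prop :=
  exists w : seq bool, w <> [::] /\ circular_factors m w = S.

Definition circ_rep_sets (m : nat) : {set {set m.-tuple bool}} :=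
  [set S : {set m.-tuple bool} |
    (S != set0) && `[< circularly_representable S >]].

(* Main.v *)
Require Import Defs.
From HB Require Import structures.
From mathcomp Require Import fingroup perm.
From mathcomp Require Import all_boot all_order all_algebra.
From mathcomp Require Import boolp reals.

Set Implicit Arguments.
Unset Strict Implicit.
Unset Printing Implicit Defensive.

Import Order.TTheory GRing.Theory Num.Theory.
Local Open Scope ring_scope.

(* Words of length n + 1 are the edges of the de Bruijn graph whose vertices  *)
(* are the words of length n, and a set of edges is circularly representable  *)
(* as soon as it is the set of edges of a closed walk.  A Hamiltonian cycle   *)
(* has 2 ^ n edges, and every edge set containing it is strongly connected,   *)
(* hence is covered by a closed walk; there are 2 ^ (2 ^ n) such sets.  The   *)
(* Hamiltonian cycle is a permutation of the vertices, sending each vertex to *)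
(* one of its successors, with the least number of orbits: if two vertices    *)
(* with the same successors were in different orbits, exchanging their images *)
(* would merge these orbits.                                                  *)

(** [overlap] is adjacency of vertices as well as of consecutive edges. [de_bruijn_cycle] gives the
    Hamiltonian cycle, [superset_representable] handles the edge sets containing it, and
    [card_supersets] counts them: at least [2 ^ n.+1 - 2 ^ n = 2 ^ n] edges remain free. *)

Definition overlap (k : nat) : rel (k.+1.-tuple bool) :=
  [rel x y : k.+1.-tuple bool | behead x == take k y].

Lemma cycle_nth_modn (T : Type) (e : rel T) (x0 : T) (s : seq T) (i : nat) :
  cycle e s -> (0 < size s)%N ->
  e (nth x0 s (i %% size s)) (nth x0 s (i.+1 %% size s)).
Proof.
case: s => [//|x p] /= /(pathP x0) H _.
have lt_i : (i %% (size p).+1 < (size p).+1)%N by rewrite ltn_mod.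
have := H (i %% (size p).+1)%N; rewrite size_rcons => /(_ lt_i).
rewrite -rcons_cons nth_rcons /= lt_i nth_rcons.
rewrite -[i.+1 in X in _ -> X]addn1 -(modnDml i) addn1.
move: lt_i; rewrite ltnS leq_eqVlt => /predU1P [->|lt_i].
  by rewrite ltnn eqxx modnn.
by rewrite lt_i (@modn_small (_ %% _).+1) ?ltnS.
Qed.

(** Each step of the walk shifts the window by one letter, so letter [j] of entry [i] is the first
    letter of entry [i + j], modulo [size s], even when the walk is shorter than the window. *)
Lemma circular_factors_cycle (k : nat) (s : seq (k.+1.-tuple bool)) :
  cycle (@overlap k) s ->
  circular_factors k.+1 [seq thead x | x <- s] = [set x in s].
Proof.
move=> s_cyc; pose x0 : k.+1.-tuple bool := [tuple of nseq k.+1 false].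
have letter i j : (0 < size s)%N -> (j < k.+1)%N ->
    nth false (nth x0 s (i %% size s)) j =
    thead (nth x0 s ((i + j) %% size s)).
  move=> s_gt0; elim: j i => [|j IHj] i lt_j.
    by rewrite addn0 /thead (tnth_nth false).
  rewrite addnS -addSn -IHj 1?ltnW // -nth_behead.
  by rewrite (eqP (cycle_nth_modn x0 i s_cyc s_gt0)) nth_take.
have factorE i : (i < size s)%N ->
    circular_factor k.+1 [seq thead x | x <- s] i = nth x0 s i.
  move=> lt_i; apply: eq_from_tnth => j; have s_gt0 := leq_ltn_trans (leq0n i) lt_i.
  rewrite tnth_mktuple size_map (nth_map x0) ?ltn_mod // -letter //.
  by rewrite modn_small // (tnth_nth false).
apply/setP => x; rewrite inE; apply/imsetP/idP => [[i _ ->]|x_s].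
  have lt_i : (i < size s)%N by rewrite -[X in (_ < X)%N](size_map (@thead _ _)).
  by rewrite factorE // mem_nth.
have lt_x : (index x s < size [seq thead x | x <- s])%N by rewrite size_map index_mem.
by exists (Ordinal lt_x); rewrite //= factorE ?index_mem // nth_index.
Qed.

Lemma strongly_connected_cycle (T : finType) (e : rel T) (S : {set T}) :
  S != set0 ->
  {in S &, forall x y,
    exists2 p, path e x (rcons p y) & {subset rcons p y <= S}} ->
  exists s, [/\ s != [::], cycle e s & [set x in s] = S].
Proof.
move=> /set0Pn[x0 x0S] walk.
(* Chain walks through all elements of [S], then return to [x0]. *)
have cover (l : seq T) x : x \in S -> {subset l <= S} ->
    exists p, [/\ path e x p, {subset p <= S} & {subset l <= p}].
  elim: l x => [|y l IHl] x xS lS; first by exists [::].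
  have yS : y \in S by apply: lS; rewrite mem_head.
  have [p xp pS] := walk x y xS yS.
  have [|q [yq qS lq]] := IHl y yS.
    by move=> z zl; apply: lS; rewrite inE zl orbT.
  exists (rcons p y ++ q); split.
  - by rewrite cat_path xp last_rcons.
  - by move=> z; rewrite mem_cat => /orP[/pS|/qS].
  - move=> z; rewrite inE mem_cat mem_rcons inE.
    by case/predU1P => [->|/lq ->]; rewrite ?eqxx ?orbT.
have [|p [x0p pS Sp]] := cover (enum S) x0 x0S.
  by move=> z; rewrite mem_enum.
have lastS : last x0 p \in S.
  by have := mem_last x0 p; rewrite inE => /predU1P [->|/pS].
have [q lq qS] := walk _ _ lastS x0S.
exists (x0 :: p ++ q); split => //=.
  by rewrite rcons_cat cat_path x0p.
apply/setP => z; rewrite inE in_cons mem_cat.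
apply/idP/idP => [/or3P[/eqP->//|/pS//|zq]|zS].
  by apply: qS; rewrite mem_rcons inE zq orbT.
by rewrite (Sp z) ?mem_enum // orbT.
Qed.

Lemma overlap_rot1 (k : nat) (x : k.+1.-tuple bool) :
  overlap x [tuple of rot 1 x].
Proof.
case/tupleP: x => a u; rewrite /overlap /= /rot /= drop0 take0.
by rewrite take_size_cat ?size_tuple.
Qed.

Lemma overlap_closed_full (k : nat) (A : {pred k.+1.-tuple bool}) :
  (forall x y, overlap x y -> x \in A -> y \in A) ->
  forall x y, x \in A -> y \in A.
Proof.
move=> A_closed x y xA.
(* Append the letters of [y] one at a time: each step drops the oldest letter, until [x] is gone.
   The form with [drop] allows induction on a word of any length. *)
suff [z zA zE] : exists2 z : k.+1.-tuple bool,
    z \in A & z = drop (size y) (x ++ y) :> seq bool.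
  rewrite (_ : y = z) //; apply: val_inj.
  by rewrite /= zE drop_size_cat // !size_tuple.
elim: (tval y) x xA => [|b c IHc] x xA.
  by exists x => //; rewrite drop0 cats0.
case/tupleP: x => a u in xA *.
have [|z zA zE] := IHc [tuple of rcons u b].
  apply: A_closed xA; rewrite /overlap /= -cats1.
  by rewrite take_size_cat ?size_tuple.
by exists z => //=; rewrite zE /= cat_rcons.
Qed.

Lemma de_bruijn_cycle (k : nat) :
  exists2 s : {perm k.+1.-tuple bool},
    forall x, overlap x (s x) & forall x y, y \in porbit s x.
Proof.
have rot1_inj : injective (fun x : k.+1.-tuple bool => [tuple of rot 1 x]).
  by move=> x y /(congr1 val) /rot_inj /val_inj.
pose P (s : {perm k.+1.-tuple bool}) := [forall x, overlap x (s x)].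
have Prot : P (perm rot1_inj) by apply/forallP => x; rewrite permE overlap_rot1.
case: (arg_minnP (fun s => #|porbits s|) Prot) => s /forallP Ps s_min.
exists s => // x y.
have same_orbit (z t : k.+1.-tuple bool) : behead z = behead t -> z \in porbit s t.
  move=> zt; apply: contraT => zNt.
  have Pt : P (tperm z t * s)%g.
    apply/forallP => u; rewrite permM.
    have := Ps (tperm z t u); rewrite /overlap /=.
    by case: tpermP => // ->; rewrite zt.
  (* Merging two orbits lowers their number, so minimality would give [2 <= (z != t)], a boolean. *)
  have := porbits_mul_tperm s z t; rewrite /= zNt => orbE.
  have := s_min _ Pt; rewrite -(leq_add2r 2) orbE leq_add2l.
  by case: (z != t).
apply: (@overlap_closed_full _ (mem (porbit s x)) _ x); last exact: porbit_id.
(* Both [z] and the preimage of [t] under [s] precede [t], so they have the same [behead] and share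
   an orbit. *)
move=> z t /eqP zt /=; rewrite -!eq_porbit_mem => /eqP <-.
have := Ps ((s^-1)%g t); rewrite /overlap /= permKV -zt => /eqP /same_orbit.
by rewrite -!eq_porbit_mem -(porbit_perm s 1) expg1 permKV.
Qed.

Section HamiltonianCycle.

Variables (k : nat) (s : {perm k.+1.-tuple bool}).
Hypothesis s_overlap : forall x, overlap x (s x).
Hypothesis s_transitive : forall x y, y \in porbit s x.

(** The edge from [x] to [s x]: by [s_overlap], its first [k.+1] letters spell [x]. *)
Definition cycle_edge (x : k.+1.-tuple bool) : k.+2.-tuple bool :=
  [tuple of thead x :: s x].

Lemma overlap_cycle_edge (t : k.+2.-tuple bool) :
  overlap t (cycle_edge [tuple of behead t]).
Proof.
set y := [tuple of behead t].
rewrite /overlap /= -(eqP (s_overlap y)).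
by rewrite -[behead t]/(tval y) {1}(tuple_eta y).
Qed.

Lemma cycle_edge_overlap (t : k.+2.-tuple bool) :
  exists x, overlap (cycle_edge x) t.
Proof.
have sz : size (take k.+1 t) == k.+1 by rewrite size_take size_tuple ltnSn.
by exists ((s^-1)%g (Tuple sz)); rewrite /overlap /= permKV.
Qed.

(** To walk from [t] to [u] inside [S], join the Hamiltonian cycle where [t] ends and follow it to
    the edge that precedes [u]. *)
Lemma superset_representable (S : {set k.+2.-tuple bool}) :
  cycle_edge @: setT \subset S -> S \in circ_rep_sets k.+2.
Proof.
move=> /subsetP DS.
have edgeS x : cycle_edge x \in S by apply/DS/imset_f.
have S_neq0 : S != set0.
  by apply/set0Pn; exists (cycle_edge [tuple of nseq k.+1 false]).
pose e := [rel t u : k.+2.-tuple bool | overlap t u && (u \in S)].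
have edge_connect x y : connect e (cycle_edge x) (cycle_edge y).
  have /porbitP[i ->] := s_transitive x y.
  elim: i => [|i IHi]; first by rewrite expg0 perm1.
  apply: connect_trans IHi (connect1 _); rewrite expgSr permM /= edgeS andbT.
  set z := (s ^+ i)%g x; rewrite (_ : s z = [tuple of behead (cycle_edge z)]).
    exact: overlap_cycle_edge.
  exact: val_inj.
rewrite inE S_neq0; apply/asboolP.
have [|c [c_neq0 c_cycle <-]] :=
  @strongly_connected_cycle _ (@overlap k.+1) S S_neq0.
  move=> t u tS uS; have [x xu] := cycle_edge_overlap u.
  have := edge_connect [tuple of behead t] x.
  case/connectP=> p ep lastp.
  exists (cycle_edge [tuple of behead t] :: p).
    rewrite /= overlap_cycle_edge rcons_path -lastp xu andbT.
    by apply: sub_path ep => v w /andP[].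
  have: all (mem S) p.
    elim: p (cycle_edge _) ep {lastp} => //= v p IHp w /andP[/andP[_ vS] /IHp].
    by rewrite vS.
  move=> /allP pS v; rewrite rcons_cons inE mem_rcons inE.
  by case/or3P => [/eqP->|/eqP->|/pS].
exists [seq thead x | x <- c]; split; last exact: circular_factors_cycle.
by case: c c_neq0 {c_cycle}.
Qed.

End HamiltonianCycle.

Lemma card_supersets (T : finType) (D : {set T}) :
  #|[set S : {set T} | D \subset S]| = (2 ^ #|~: D|)%N.
Proof.
rewrite -card_powerset -[RHS](card_in_imset (f := fun S => D :|: S)).
  apply: eq_card => S; rewrite inE.
  apply/idP/imsetP => [DS|[U _ ->]]; last exact: subsetUl.
  exists (S :\: D); first by rewrite inE setDE subsetIr.
  by rewrite -{1}(setIidPr DS) setID.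
move=> S U; rewrite !inE -!disjoints_subset => SD UD /setP SU.
apply/setP => x; have := SU x; rewrite !inE.
case: (boolP (x \in D)) => //= xD _.
by rewrite !(disjointFl _ xD).
Qed.

Theorem corollary5 (R : realType) (n : nat) (hn : (1 <= n)%N) :
  (#|circ_rep_sets n.+1| >= 2 ^ (2 ^ n))%N /\
  (2 ^ (2 ^ n))%N%:R = Num.sqrt (2 : R) ^+ (2 ^ n.+1)%N.
Proof.
split; last by rewrite expnS exprM sqr_sqrtr ?ler0n // natrX.
case: n hn => [//|k] _.
have [s s_overlap s_transitive] := de_bruijn_cycle k.
set D := cycle_edge s @: setT.
have cardD : (#|D| <= 2 ^ k.+1)%N.
  by rewrite (leq_trans (leq_imset_card _ _)) // cardsT card_tuple card_bool.
apply: (@leq_trans #|[set S : {set k.+2.-tuple bool} | D \subset S]|).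
  rewrite card_supersets leq_exp2l // cardsCs setCK card_tuple card_bool.
  by rewrite leq_subRL ?(leq_trans cardD) ?leq_exp2l // [(2 ^ k.+2)%N]expnS
    mul2n -addnn leq_add2r.
apply/subset_leq_card/subsetP => S; rewrite inE.
exact: superset_representable.
Qed.
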